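(* There exists no natural deformation quantization on Poisson manifolds. That is, there does not exist a $\star$-product $$f\star g=fg+\varepsilon\{f,g\}+\dots+\varepsilon^m\beta_m(f,g)+\cdots$$ given by one and the same universal formula for all Poisson manifolds, in the sense that its terms $\beta_m$ ($m=1,2,\dots$) are natural differential operations on Poisson manifolds and the formula defines a deformation quantization of every Poisson manifold.
   Context: $\mathbb K=\mathbb R$ or $\mathbb C$. Manifolds are smooth $\mathbb K$-manifolds (real smooth if $\mathbb K=\mathbb R$, complex analytic if $\mathbb K=\mathbb C$); $\mathcal O$ denotes the sheaf of differentiable $\mathbb K$-valued functions on a manifold $M$. Summation over repeated upper and lower indices is understood. A Poisson structure on $M$ is a bivector field $\beta\in\Gamma(M,\bigwedge^2 TM)$ with $[\beta,\beta]=0$ (Schouten bracket, given in local coordinates by $[\beta,\beta]=\beta^{ij}\partial_i\beta^{kl}\,\partial_j\wedge\partial_k\wedge\partial_l$). A Poisson manifold is a manifold with a Poisson structure; its Poisson bracket on $\mathcal O$ is $\{f,g\}=\beta(df,dg)=\beta^{ij}\,\partial_i f\,\partial_j g$. A deformation quantization of a Poisson manifold $(M,\beta)$ is an associative product $\star$ on the sheaf $\mathcal O[[\varepsilon]]$ of formal power series with coefficients in $\mathcal O$ that is $\mathbb K[[\varepsilon]]$-linear with respect to infinite formal sums and is defined on $\mathcal O$ by a formula $f\star g=fg+\varepsilon\{f,g\}+\dots+\varepsilon^m\beta_m(f,g)+\cdots$, where $\beta_m$ ($m=1,2,\dots$) are bilinear differential operators (so $\beta_1(f,g)=\{f,g\}$).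 Naturality: the notion refers to manifolds of a given dimension $n$. The term $\beta_m$ is a natural differential operation on Poisson manifolds if the value of $\beta_m(f,g)$ at a point depends only on the values at that point of $f$, $g$, the components of the Poisson bivector $\beta$ (as a parameter), and their partial derivatives up to some fixed finite order, via one and the same differentiable expression in every local coordinate system, at every point, and on every $n$-dimensional Poisson manifold. Equivalently, $\beta_m$ is induced by a single map from (jets at $0\in\mathbb K^n$ of pairs of functions) $\times$ (jets at $0$ of local Poisson structures) to $\mathbb K$ that is invariant under the group of jets at $0$ (of a sufficiently high order) of local diffeomorphisms of $\mathbb K^n$ fixing $0$. *)

(* Defs.v *)
From HB Require Import structures.
From mathcomp Require Import all_boot all_order all_algebra.
From mathcomp Require Import all_classical all_reals all_analysis.
From mathcomp.real_closed Require Export complex.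

Set Implicit Arguments.
Unset Strict Implicit.
Unset Printing Implicit Defensive.

Import Order.TTheory GRing.Theory Num.Theory.
Import numFieldNormedType.Exports.

Local Open Scope classical_set_scope.
Local Open Scope ring_scope.

(* Everything is written for a numFieldType K; it is meant for K = R and
   K = R[i] with R : realType.  All derivatives are K-derivatives. *)

Section Calculus.
Variables (K : numFieldType) (N : nat).
Implicit Types (f : 'rV[K]_N -> K) (U S : set 'rV[K]_N).

Definition partial (i : 'I_N) f : 'rV[K]_N -> K := 'D_(delta_mx 0 i) f.

(* iter_partial [:: i1; ..; ir] f = d_i1 (.. (d_ir f)). *)
Definition iter_partial (s : seq 'I_N) f : 'rV[K]_N -> K := foldr partial f s.

(* On an open set U: C^oo for real K, and holomorphic (= complex analytic)
   for complex K. *)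
Definition smooth_on U f : Prop :=
  forall s x, U x -> differentiable (iter_partial s f) x.

(* Differentiability on an arbitrary subset S: local extendability to a smooth
   function on an open set. *)
Definition smooth_on_subset S f : Prop :=
  forall z, S z -> exists W f',
    [/\ open W, W z, smooth_on W f' & forall y, S y -> W y -> f' y = f y].

(* Components b^{ij} of a Poisson bivector field on U.  The last condition is
   [b, b] = 0: as b is antisymmetric, the coefficient of d_j /\ d_k /\ d_l,
   j < k < l, in b^{ij} d_i b^{kl} d_j /\ d_k /\ d_l is twice the cyclic sum
   below, which vanishes identically when two of j, k, l coincide. *)
Definition local_poisson U (b : 'rV[K]_N -> 'M[K]_N) : Prop :=
  [/\ forall i j, smooth_on U (fun x => b x i j),
      forall x, U x -> (b x)^T = - b x
    & forall x j k l, U x ->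
        \sum_(i < N) (b x i j * partial i (fun y => b y k l) x
                    + b x i k * partial i (fun y => b y l j) x
                    + b x i l * partial i (fun y => b y j k) x) = 0].

(* Coordinates on the k-jets of triples (f, g, b).  A partial derivative of
   order r <= k is indexed by the sequence of its r directions, so equal mixed
   partial derivatives occur as several coordinates. *)
Definition jet_index (k : nat) : finType :=
  ((k.-bseq 'I_N + k.-bseq 'I_N) + ('I_N * 'I_N * k.-bseq 'I_N))%type.

Definition jet (k : nat) f (g : 'rV[K]_N -> K) (b : 'rV[K]_N -> 'M[K]_N)
    (x : 'rV[K]_N) : 'rV[K]_#|jet_index k| :=
  \row_a match (enum_val a : jet_index k) with
         | inl (inl s) => iter_partial s f x
         | inl (inr s) => iter_partial s g x
         | inr (i, j, s) => iter_partial s (fun y => b y i j) x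
         end.

Definition poisson_jets (k : nat) : set 'rV[K]_#|jet_index k| :=
  [set z | exists U f g b x,
     [/\ open U /\ U x, smooth_on U f, smooth_on U g, local_poisson U b
       & z = jet k f g b x]].

End Calculus.

Section Manifolds.
Variables (K : numFieldType) (n : nat).

(* The values of cmap outside cdom, and of cinv outside cmap @` cdom, are
   irrelevant. *)
Record chart (M : topologicalType) := Chart {
  cdom : set M;
  cmap :> M -> 'rV[K]_n;
  cinv : 'rV[K]_n -> M;
  cdom_open : open cdom;
  cimg_open : open (cmap @` cdom);
  cmapK : forall p, cdom p -> cinv (cmap p) = p;
  cmap_continuous : forall p, cdom p -> {for p, continuous cmap};
  cinv_continuous : forall x, (cmap @` cdom) x -> {for x, continuous cinv}
}.

Definition smooth_transition (M : topologicalType) (c c' : chart M) : Prop :=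
  forall k, smooth_on (c @` (cdom c `&` cdom c'))
                      (fun y => c' (cinv c y) 0 k).

Record manifold := Manifold {
  carrier :> topologicalType;
  carrier_hausdorff : hausdorff_space carrier;
  carrier_second_countable : @second_countable carrier;
  atlas : set (chart carrier);
  atlas_cover : forall p, exists2 c, atlas c & cdom c p;
  atlas_compatible : forall c c', atlas c -> atlas c' -> smooth_transition c c'
}.

(* Membership in the maximal atlas: c is a local coordinate system on M. *)
Definition admissible (M : manifold) (c : chart M) : Prop :=
  forall c', atlas c' -> smooth_transition c c' /\ smooth_transition c' c.

Definition jacobian (M : topologicalType) (c c' : chart M) (p : M) : 'M[K]_n :=
  \matrix_(k, i) partial i (fun y => c' (cinv c y) 0 k) (c p).

(* A bivector field is given by its components in all local coordinate
   systems, related by the transformation law of bivectors.  Smoothness and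
   [b, b] = 0 do not depend on coordinates and are required in an atlas. *)
Record poisson (M : manifold) := Poisson {
  components :> chart M -> 'rV[K]_n -> 'M[K]_n;
  components_transform : forall c c' p,
    atlas c -> admissible c' -> cdom c p -> cdom c' p ->
    components c' (c' p)
      = jacobian c c' p *m components c (c p) *m (jacobian c c' p)^T;
  components_poisson : forall c,
    atlas c -> local_poisson (c @` cdom c) (components c)
}.

Section Functions.
Variable M : manifold.
Implicit Types (U V : set M) (f g : M -> K) (F G H : nat -> M -> K).

(* f restricts to a section of the sheaf O over the open set U; the values of
   f outside U are irrelevant. *)
Definition in_O U f : Prop :=
  forall c, atlas c -> smooth_on (c @` (cdom c `&` U)) (f \o cinv c).

(* Sections of O[[eps]]: F m is the coefficient of eps^m. *)
Definition in_Oeps U F : Prop := forall m, in_O U (F m).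

Definition const_series f : nat -> M -> K :=
  fun m => if m == 0%N then f else fun=> 0.

Definition bracket_in (P : poisson M) (c : chart M) f g (p : M) : K :=
  \sum_(i < n) \sum_(j < n)
    P c (c p) i j * partial i (f \o cinv c) (c p)
                  * partial j (g \o cinv c) (c p).

(* B : O x O -> O, given on sections over each open set U. *)
Definition bidifferential (B : set M -> (M -> K) -> (M -> K) -> M -> K) :=
  forall p, exists (c : chart M) (W : set M) (k : nat)
                   (a : k.-bseq 'I_n -> k.-bseq 'I_n -> 'rV[K]_n -> K),
    [/\ atlas c, open W /\ W p, W `<=` cdom c,
        forall s t, smooth_on (c @` W) (a s t)
      & forall U f g q, open U -> in_O U f -> in_O U g -> U q -> W q ->
          B U f g q = \sum_s \sum_t
            a s t (c q) * iter_partial s (f \o cinv c) (c q)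
                        * iter_partial t (g \o cinv c) (c q)].

Definition product :=
  set M -> (nat -> M -> K) -> (nat -> M -> K) -> nat -> M -> K.

(* beta_m(f, g), the coefficient of eps^m in f * g for f, g in O(U). *)
Definition term (star : product) (m : nat) U f g : M -> K :=
  star U (const_series f) (const_series g) m.

Record deformation_quantization (P : poisson M) (star : product) : Prop :=
  DeformationQuantization {
  dq_section : forall U F G, open U -> in_Oeps U F -> in_Oeps U G ->
    in_Oeps U (star U F G);
  (* Compatibility with restriction; for V = U it says that star only depends
     on the values of its arguments on U. *)
  dq_restriction : forall U V F G F' G', open U -> open V -> V `<=` U ->
    in_Oeps U F -> in_Oeps U G -> in_Oeps V F' -> in_Oeps V G' ->
    (forall m p, V p -> F' m p = F m p) ->
    (forall m p, V p -> G' m p = G m p) ->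
    forall m p, V p -> star V F' G' m p = star U F G m p;
  (* (\sum_i eps^i F_i) * (\sum_j eps^j G_j) = \sum_(i, j) eps^(i+j) F_i * G_j *)
  dq_linear : forall U F G, open U -> in_Oeps U F -> in_Oeps U G ->
    forall m p, U p ->
    star U F G m p = \sum_(i < m.+1) \sum_(j < (m - i).+1)
                       term star (m - i - j) U (F i) (G j) p;
  dq_assoc : forall U F G H, open U ->
    in_Oeps U F -> in_Oeps U G -> in_Oeps U H ->
    forall m p, U p ->
    star U (star U F G) H m p = star U F (star U G H) m p;
  dq_term0 : forall U f g, open U -> in_O U f -> in_O U g ->
    forall p, U p -> term star 0 U f g p = f p * g p;
  dq_term1 : forall U f g, open U -> in_O U f -> in_O U g ->
    forall c p, admissible c -> cdom c p -> U p ->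
    term star 1 U f g p = bracket_in P c f g p;
  dq_bidifferential : forall m, (0 < m)%N -> bidifferential (term star m)
}.

End Functions.

Definition product_family := forall M : manifold, poisson M -> product M.

(* One expression E in the k-jets computes beta_m at every point, in every
   local coordinate system, on every n-dimensional Poisson manifold. *)
Definition natural_term (star : product_family) (m : nat) : Prop :=
  exists (k : nat) (E : 'rV[K]_#|jet_index n k| -> K),
    smooth_on_subset (@poisson_jets K n k) E /\
    forall (M : manifold) (P : poisson M) (U : set M) (f g : M -> K)
           (c : chart M) (p : M),
      open U -> in_O U f -> in_O U g -> admissible c -> cdom c p -> U p ->
      term (star M P) m U f g p
        = E (jet k (f \o cinv c) (g \o cinv c) (P c) (c p)).

Definition natural_deformation_quantization (star : product_family) : Prop :=
  (forall m, (0 < m)%N -> natural_term star m) /\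
  (forall (M : manifold) (P : poisson M),
     deformation_quantization P (star M P)).

End Manifolds.

(* Main.v *)
(* On K^n take the constant Poisson structure with {x, y} = 1 for the first two
   coordinates, and let B be the value of beta_2 at the origin.  Polynomial
   automorphisms of the (x, y)-plane that fix 0 and preserve the bracket are
   local coordinate systems in which the bivector has the same components, so
   naturality makes B invariant under them.
   - Scaling (2x, y/2): B(x^a y^b, x^c y^d) = 0 unless a + c = b + d.
   - The shear (x + y, y) applied to B(y, x^3) = 0 and B(x^3, y) = 0 gives
     B(y, x^2 y) = B(x^2 y, y) = 0.
   - The shear (x, y + x^2) applied to B(y^2, y) = 0 gives
     B(y^2, x^2) + 2 B(x^2 y, y) = 0, hence B(y^2, x^2) = 0.
   Associativity for (y, y, x^2) in order eps^2, evaluated at 0, reads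
   B(y^2, x^2) = B(y, x^2 y) + {y, {y, x^2}} = B(y, x^2 y) + 2, i.e. 0 = 2. *)
From HB Require Import structures.
Require Import Defs.
From mathcomp Require Import all_boot all_order all_algebra all_reals.
From mathcomp Require Import all_classical all_analysis.
From mathcomp Require Import ring lra.

Set Implicit Arguments.
Unset Strict Implicit.
Unset Printing Implicit Defensive.

Import Order.TTheory GRing.Theory Num.Theory.
Import numFieldNormedType.Exports.

Local Open Scope classical_set_scope.
Local Open Scope ring_scope.

(** * Polynomial functions on [K]-vectors and their partial derivatives *)

Section PolynomialFunctions.
Variables (K : numFieldType) (n : nat).
Implicit Types (f g : 'rV[K]_n -> K) (i j : 'I_n).

(** All charts and test functions of the argument are polynomial. The generators are constants,
    coordinates, sums and products only, so differences are written below with the coefficient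
    [-1]. *)
Inductive polyfun : ('rV[K]_n -> K) -> Prop :=
| polyfun_cst a : polyfun (fun=> a)
| polyfun_coord i : polyfun (fun v => v 0 i)
| polyfunD f g : polyfun f -> polyfun g -> polyfun (fun v => f v + g v)
| polyfunM f g : polyfun f -> polyfun g -> polyfun (fun v => f v * g v).

Definition polymap (phi : 'rV[K]_n -> 'rV[K]_n) :=
  forall k, polyfun (fun v => phi v 0 k).

Lemma polyfun_comp f phi : polyfun f -> polymap phi -> polyfun (f \o phi).
Proof.
move=> + phiP; elim=> [a|i|{}f g _ IHf _ IHg|{}f g _ IHf _ IHg].
- exact: polyfun_cst.
- exact: phiP.
- exact: (polyfunD IHf IHg).
- exact: (polyfunM IHf IHg).
Qed.

Lemma polyfunX f m : polyfun f -> polyfun (fun v => f v ^+ m).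
Proof.
move=> fP; elim: m => [|m IH]; first exact: polyfun_cst.
by under eq_fun do rewrite exprS; exact: polyfunM.
Qed.

Lemma polyfun_differentiable f v : polyfun f -> differentiable f v.
Proof.
elim=> [a|i|{}f g _ IHf _ IHg|{}f g _ IHf _ IHg].
- exact: differentiable_cst.
- exact: differentiable_coord.
- exact: (differentiableD IHf IHg).
- exact: (differentiableM IHf IHg).
Qed.

Lemma polyfun_derivable f v w : polyfun f -> derivable f v w.
Proof. by move=> fP; apply/diff_derivable/polyfun_differentiable. Qed.

Lemma partial_cst i (a : K) : partial i (fun=> a) = fun=> 0.
Proof. by apply/funext => v; exact: derive_cst. Qed.

Lemma partial_coord i j :
  partial i (fun v : 'rV[K]_n => v 0 j) = fun=> (j == i)%:R.
Proof.
pose c (v : 'rV[K]_n) := v 0 j.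
have c_lin : linear c by move=> a u v; rewrite /c !mxE.
(* A coordinate, packed as a continuous linear form, is its own differential. *)
pose L : {linear 'rV[K]_n -> K} := HB.pack c (GRing.isLinear.Build _ _ _ _ c c_lin).
apply/funext => v; rewrite -[fun v => _]/(L : _ -> _).
have Lc : continuous L by exact: coord_continuous.
rewrite /partial deriveE; last exact: linear_differentiable.
by rewrite diff_lin// /L /= /c mxE eqxx.
Qed.

Lemma partialD i f g : polyfun f -> polyfun g ->
  partial i (fun v => f v + g v) = fun v => partial i f v + partial i g v.
Proof.
by move=> fP gP; apply/funext => v; apply: deriveD; exact: polyfun_derivable.
Qed.

Lemma partialM i f g : polyfun f -> polyfun g ->
  partial i (fun v => f v * g v) =
  fun v => f v * partial i g v + g v * partial i f v.
Proof.
by move=> fP gP; apply/funext => v; apply: deriveM; exact: polyfun_derivable.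
Qed.

Lemma polyfun_partial i f : polyfun f -> polyfun (partial i f).
Proof.
elim=> [a|j|{}f g fP IHf gP IHg|{}f g fP IHf gP IHg].
- by rewrite partial_cst; exact: polyfun_cst.
- by rewrite partial_coord; exact: polyfun_cst.
- by rewrite partialD//; exact: polyfunD.
- by rewrite partialM//; apply: polyfunD; exact: polyfunM.
Qed.

Lemma polyfun_iter_partial s f : polyfun f -> polyfun (iter_partial s f).
Proof. by move=> fP; elim: s => //= i s IH; exact: polyfun_partial. Qed.

(** Polynomial functions are closed under [partial], so every iterated derivative is again
    differentiable. *)
Lemma polyfun_smooth U f : polyfun f -> smooth_on U f.
Proof.
by move=> fP s x _; apply: polyfun_differentiable; exact: polyfun_iter_partial.
Qed.

Lemma iter_partialP s a f g : polyfun f -> polyfun g ->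
  iter_partial s (fun v => a * f v + g v) =
  fun v => a * iter_partial s f v + iter_partial s g v.
Proof.
move=> fP gP; elim: s => //= i s ->.
have aP := polyfun_cst a.
have sfP := polyfun_iter_partial s fP.
have sgP := polyfun_iter_partial s gP.
rewrite partialD//; last exact: polyfunM.
by rewrite partialM// partial_cst; apply/funext => v; rewrite mulr0 addr0.
Qed.

Lemma polymap_continuous phi : polymap phi -> continuous phi.
Proof.
move=> phiP v; suff : differentiable phi v by exact: differentiable_continuous.
rewrite (_ : phi = fun v => \sum_i phi v 0 i *: delta_mx 0 i); last first.
  by apply/funext => w; rewrite {1}[phi w]row_sum_delta.
rewrite -fct_sumE; apply: differentiable_sum => i.
exact/differentiableZl/polyfun_differentiable.
Qed.

End PolynomialFunctions.

(** * Second countability of the model space over the real and the complex numbers *)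

Lemma second_countable_rV (K : numFieldType) (n : nat) (T : countType) (d : T -> K) :
  (forall e : K, 0 < e -> exists k : nat, k.+1%:R^-1 < e) ->
  (forall x e : K, 0 < e -> exists t, `|x - d t| < e) ->
  @second_countable 'rV[K]_n.
Proof.
move=> archi dense_d.
pose bl k (s : {ffun 'I_n -> T}) :=
  (ball (\row_i d (s i) : 'rV[K]_n) (k.+1%:R^-1 : K))°.
exists (\bigcup_k range (bl k)).
  by apply: bigcup_countable => // k _;
    apply: sub_countable (card_image_le _ _) _; exact: countableP.
split; first by move=> _ [k _ [v _ <-]]; exact: open_interior.
move=> x V /nbhs_ballP[e /= e0 eV].
(* The basic ball has radius below [e / 2], and its centre is chosen within half that radius of [x].
   Thus [x] is interior to it and the triangle inequality keeps it inside the ball of radius [e]. *)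
have [k ke] : exists k : nat, k.+1%:R^-1 < e / 2 by apply: archi; exact: divr_gt0.
have k0 : 0 < k.+1%:R^-1 :> K by rewrite invr_gt0 ltr0n.
have k20 : 0 < k.+1%:R^-1 / 2 :> K by exact: divr_gt0.
have /choice[w wP] i := dense_d (x 0 i) _ k20.
pose s := [ffun i => w i].
have xs : ball x (k.+1%:R^-1 / 2) (\row_i d (s i)).
  by split=> // i j; rewrite ord1 mxE ffunE -ball_normE /=; exact: wP.
exists (bl k s) => /=.
  split; first by exists k => //; exists s.
  apply/nbhs_ballP; exists (k.+1%:R^-1 / 2) => //= z xz.
  rewrite [k.+1%:R^-1]splitr; exact: ball_triangle (ball_sym xs) xz.
move=> z /interior_subset sz; apply: eV; rewrite [e]splitr.
apply: (ball_triangle (y := \row_i d (s i))); last exact: le_ball (ltW ke) _ sz.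
by apply: le_ball xs; rewrite (le_trans _ (ltW ke))// ler_pdivrMr// ler_peMr ?ltW ?ltr1n.
Qed.

Lemma ratr_approx (R : realType) (x e : R) :
  0 < e -> exists q : rat, `|x - ratr q| < e.
Proof.
move=> e0; have [||z [xq [q _ qz]]] := @dense_rat R (ball x e).
- by exists x; exact: ballxx.
- exact: ball_open.
- by exists q; move: xq; rewrite -qz -ball_normE.
Qed.

Lemma second_countable_real (R : realType) (n : nat) :
  @second_countable 'rV[R]_n.
Proof.
apply: (@second_countable_rV _ _ _ (@ratr R)); last exact: ratr_approx.
move=> e e0; have [k] := @ltr_add_invr R 0 e e0.
by rewrite add0r => ke; exists k.
Qed.

Lemma second_countable_complex (R : realType) (n : nat) :
  @second_countable 'rV[(complex R : numFieldType)]_n.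
Proof.
apply: (@second_countable_rV _ _ _
  (fun q : rat * rat => (ratr q.1 +i* ratr q.2)%C : complex R)).
(* A positive complex number has zero imaginary part, so the bounds reduce to real ones. *)
- move=> [a b]; rewrite ltcE /= => /andP[/eqP -> a0].
  have [k] := @ltr_add_invr R 0 _ a0; rewrite add0r => ke; exists k.
  by rewrite -(rmorph_nat (real_complex R)) -fmorphV ltcR.
- move=> [x y] [a b]; rewrite ltcE /= => /andP[/eqP -> a0].
  (* Errors below [a / 2] in both parts give a squared modulus below [a ^+ 2 / 2]. *)
  have a20 : 0 < a / 2 by exact: divr_gt0.
  have [p pP] := ratr_approx x a20; have [q qP] := ratr_approx y a20.
  exists (p, q); rewrite normc_def ltcR /=.
  rewrite -[ltRHS]gtr0_norm// -sqrtr_sqr ltr_sqrt ?exprn_gt0//.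
  rewrite -(real_normK (num_real (x - _))) -(real_normK (num_real (y - _))).
  have := normr_ge0 (x - ratr p); have := normr_ge0 (y - ratr q).
  by move: pP qP; nra.
Qed.

(** * Affine space with a constant planar Poisson structure, and its polynomial charts *)

Section Model.
Variables (K : numFieldType) (n : nat).
Hypothesis rV_second_countable : @second_countable 'rV[K]_n.
Variables (i0 i1 : 'I_n).
Hypothesis i01 : i0 != i1.
Local Notation V := 'rV[K]_n.
Implicit Types (f g : V -> K) (phi psi : V -> V).

Lemma cancel_image_setT phi psi : cancel psi phi -> phi @` setT = setT.
Proof. by move=> psiK; apply/seteqP; split=> // y _; exists (psi y). Qed.

Section PolynomialChart.
Variables phi psi : V -> V.
Hypotheses (phiK : cancel phi psi) (psiK : cancel psi phi).
Hypotheses (phiP : polymap phi) (psiP : polymap psi).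

Definition poly_chart : chart K n V.
Proof.
apply: (@Chart K n V setT phi psi) => [||p _|p _|x _].
- exact: openT.
- by rewrite (cancel_image_setT psiK); exact: openT.
- exact: phiK.
- exact: polymap_continuous.
- exact: polymap_continuous.
Defined.

End PolynomialChart.

Lemma polymap_id : polymap (@id V).
Proof. by move=> k; exact: polyfun_coord. Qed.

Definition id_chart : chart K n V :=
  @poly_chart id id (fun=> erefl) (fun=> erefl) polymap_id polymap_id.

(** With the identity as its only atlas chart, checks over the atlas concern one chart; polynomial
    automorphisms enter as admissible charts. *)
Definition affine_space : manifold K n.
Proof.
apply: (@Manifold K n V _ rV_second_countable [set id_chart]).
- exact: norm_hausdorff.
- by move=> p; exists id_chart.
- by move=> _ _ -> -> k; apply: polyfun_smooth; exact: polyfun_coord.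
Defined.

Lemma poly_chart_admissible phi psi phiK psiK phiP psiP :
  @admissible _ _ affine_space (@poly_chart phi psi phiK psiK phiP psiP).
Proof. by move=> _ ->; split=> k; apply: polyfun_smooth; [exact: psiP|exact: phiP]. Qed.

Definition planar_bivector : 'M[K]_n := delta_mx i0 i1 - delta_mx i1 i0.

Lemma mul_planar_bivector m p (A : 'M[K]_(m, n)) (B : 'M[K]_(n, p)) k l :
  (A *m planar_bivector *m B) k l = A k i0 * B i1 l - A k i1 * B i0 l.
Proof.
have delta i j : (A *m delta_mx i j *m B) k l = A k i * B j l.
  rewrite -(mul_delta_mx (0 : 'I_1)) mulmxA -colE -mulmxA -rowE.
  by rewrite !mxE big_ord1 !mxE.
by rewrite mulmxBr mulmxBl mxE delta mxE delta.
Qed.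

(** A Poisson structure needs components in every chart. They are transported from [id_chart], so
    the transformation law holds by construction. *)
Definition planar_components (c : chart K n V) (y : V) : 'M[K]_n :=
  let J := Defs.jacobian id_chart c (cinv c y) in J *m planar_bivector *m J^T.

Lemma planar_components_id y : planar_components id_chart y = planar_bivector.
Proof.
rewrite /planar_components (_ : Defs.jacobian _ _ _ = 1%:M).
  by rewrite trmx1 mul1mx mulmx1.
by apply/matrixP => k i; rewrite !mxE partial_coord.
Qed.

Definition planar_poisson : poisson affine_space.
Proof.
apply: (@Poisson K n affine_space planar_components).
- move=> _ c' p -> _ _ c'p.
  by rewrite planar_components_id {1}/planar_components cmapK.
- move=> _ ->.
  have -> : planar_components id_chart = fun=> planar_bivector.
    by apply/funext => y; exact: planar_components_id.
  split=> [i j|x _|x j k l _].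
  + apply: polyfun_smooth; exact: polyfun_cst.
  + by rewrite linearB /= !trmx_delta opprB.
  + by apply: big1 => i _; rewrite !partial_cst !mulr0 !addr0.
Defined.

Definition planar_bracket f g v : K :=
  partial i0 f v * partial i1 g v - partial i1 f v * partial i0 g v.

Lemma bracket_inE f g v :
  bracket_in planar_poisson id_chart f g v = planar_bracket f g v.
Proof.
rewrite /bracket_in.
have -> : planar_bracket f g v =
    ((\row_i partial i f v) *m planar_bivector *m (\col_j partial j g v)) 0 0.
  by rewrite mul_planar_bivector !mxE.
transitivity (\sum_i \sum_j planar_bivector i j * partial i f v * partial j g v).
  apply: eq_bigr => i _; apply: eq_bigr => j _.
  by rewrite [planar_poisson _ _]planar_components_id.
rewrite mxE exchange_big; apply: eq_bigr => j _.
rewrite [in RHS]mxE mulr_suml mxE; apply: eq_bigr => i _.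
by rewrite [in RHS]mxE [_ * partial i f v]mulrC.
Qed.

(** Only the two planar coordinates change; the others are kept, which handles every dimension at
    once. *)
Definition planar_map (a b : V -> K) (v : V) : V :=
  \row_k if k == i0 then a v else if k == i1 then b v else v 0 k.

Lemma planar_map_polymap a b : polyfun a -> polyfun b -> polymap (planar_map a b).
Proof.
move=> aP bP k; under eq_fun do rewrite mxE.
by case: eqP => _ //; case: eqP => _ //; exact: polyfun_coord.
Qed.

(* The (k, l) entry of J *m planar_bivector *m J^T, for J the jacobian of a
   map, is the bracket of its k-th and l-th components. *)
Lemma planar_components_symplectic a b psi phiK psiK phiP psiP :
  (forall v, planar_bracket a b v = 1) ->
  planar_components (@poly_chart (planar_map a b) psi phiK psiK phiP psiP)
  = fun=> planar_bivector.
Proof.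
move=> ab1; apply/funext => y; apply/matrixP => k l.
rewrite mul_planar_bivector !mxE /=.
set v := psi y.
have partial_map i j : partial i (fun v => planar_map a b v 0 j) v =
    if j == i0 then partial i a v else if j == i1 then partial i b v
    else (j == i)%:R.
  under eq_fun do rewrite mxE.
  by case: eqP => // _; case: eqP => // _; rewrite partial_coord.
rewrite !partial_map -/v; have := ab1 v; rewrite /planar_bracket.
have i10 : i1 == i0 = false by rewrite eq_sym (negPf i01).
(* Rows of the jacobian outside [i0] and [i1] vanish in columns [i0] and [i1]. Diagonal entries
   cancel, and the two mixed entries are the bracket of [a] and [b] up to sign. *)
have [->|k0] := eqVneq k i0; have [->|l0] := eqVneq l i0;
  rewrite ?eqxx ?i10 ?(negPf i01) /= => ab.
- by rewrite [X in X - _]mulrC !subrr.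
- by have [_|_] := eqVneq l i1 => /=; rewrite ?mulr0 subr0 // subrr.
- have [_|_] := eqVneq k i1 => /=; rewrite ?mul0r sub0r ?oppr0 ?subr0 //.
  by rewrite -ab opprB [X in X - _]mulrC [X in _ - X]mulrC.
- have [_|_] := eqVneq k i1; have [_|_] := eqVneq l i1;
    rewrite /= ?mul0r ?mulr0 ?subrr //.
  by rewrite [X in X - _]mulrC !subrr.
Qed.

(** * Bilinearity, invariance and associativity of the terms of a supposed natural product *)

Section Contradiction.
Variable star : product_family K n.
Hypothesis star_natural : natural_deformation_quantization star.

Local Notation S := (@star affine_space planar_poisson).
Local Notation T := (@term K n affine_space S).
Local Notation B f g := (T 2 setT f g 0).

Let dq : deformation_quantization planar_poisson S := star_natural.2 _ _.

Lemma polyfun_in_O f : polyfun f -> @in_O _ _ affine_space setT f.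
Proof. by move=> fP _ ->; exact: polyfun_smooth. Qed.

Lemma polyfun_in_Oeps f : polyfun f ->
  @in_Oeps _ _ affine_space setT (@const_series _ _ affine_space f).
Proof.
move=> fP m; rewrite /const_series; case: eqP => _; apply: polyfun_in_O => //.
exact: polyfun_cst.
Qed.

(** Linearity is read off the local bidifferential formula, whose derivatives are linear;
    [dq_linear] only expands series into coefficients. *)
Lemma termPl m a f g h p : (0 < m)%N -> polyfun f -> polyfun g -> polyfun h ->
  T m setT (fun v => a * f v + g v) h p = a * T m setT f h p + T m setT g h p.
Proof.
move=> m0 fP gP hP.
have [c [W [k [A [/= -> [_ Wp] _ _ AE]]]]] := dq_bidifferential dq m0 p.
have afgP := polyfunD (polyfunM (polyfun_cst _ a) fP) gP.
rewrite !(AE setT) ?inE//; try exact: openT; try exact: polyfun_in_O.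
rewrite mulr_sumr -big_split; apply: eq_bigr => s _ /=.
rewrite mulr_sumr -big_split; apply: eq_bigr => t _ /=.
rewrite iter_partialP//; ring.
Qed.

Lemma termPr m a f g h p : (0 < m)%N -> polyfun f -> polyfun g -> polyfun h ->
  T m setT h (fun v => a * f v + g v) p = a * T m setT h f p + T m setT h g p.
Proof.
move=> m0 fP gP hP.
have [c [W [k [A [/= -> [_ Wp] _ _ AE]]]]] := dq_bidifferential dq m0 p.
have afgP := polyfunD (polyfunM (polyfun_cst _ a) fP) gP.
rewrite !(AE setT) ?inE//; try exact: openT; try exact: polyfun_in_O.
rewrite mulr_sumr -big_split; apply: eq_bigr => s _ /=.
rewrite mulr_sumr -big_split; apply: eq_bigr => t _ /=.
rewrite iter_partialP//; ring.
Qed.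

Lemma termZl m a f h p : (0 < m)%N -> polyfun f -> polyfun h ->
  T m setT (fun v => a * f v) h p = a * T m setT f h p.
Proof.
move=> m0 fP hP.
have -> : (fun v => a * f v) = fun v => (a - 1) * f v + f v.
  by apply/funext => v; rewrite mulrBl mul1r subrK.
by rewrite termPl// mulrBl mul1r subrK.
Qed.

Lemma termZr m a f h p : (0 < m)%N -> polyfun f -> polyfun h ->
  T m setT h (fun v => a * f v) p = a * T m setT h f p.
Proof.
move=> m0 fP hP.
have -> : (fun v => a * f v) = fun v => (a - 1) * f v + f v.
  by apply/funext => v; rewrite mulrBl mul1r subrK.
by rewrite termPr// mulrBl mul1r subrK.
Qed.

(** In the chart [planar_map a b], the pulled-back functions have the expressions [f] and [g], the
    bivector keeps its components, and the origin keeps its coordinates. The universal expression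
    therefore receives the same jet as for [f] and [g] in [id_chart]. *)
Lemma term_planar_map m a b a' b' f g : (0 < m)%N ->
  polyfun a -> polyfun b -> polyfun a' -> polyfun b' ->
  cancel (planar_map a b) (planar_map a' b') ->
  cancel (planar_map a' b') (planar_map a b) ->
  (forall v, planar_bracket a b v = 1) -> a 0 = 0 -> b 0 = 0 ->
  polyfun f -> polyfun g ->
  T m setT (f \o planar_map a b) (g \o planar_map a b) 0 = T m setT f g 0.
Proof.
move=> m0 aP bP a'P b'P abK a'b'K ab1 a0 b0 fP gP.
have phiP := planar_map_polymap aP bP; have psiP := planar_map_polymap a'P b'P.
have [k [E [_ TE]]] := star_natural.1 m m0.
pose c := poly_chart abK a'b'K phiP psiP.
have f'P := polyfun_comp fP phiP; have g'P := polyfun_comp gP phiP.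
rewrite (TE affine_space planar_poisson _ _ _ c)//; first last.
- exact: poly_chart_admissible.
- exact: polyfun_in_O.
- exact: polyfun_in_O.
- exact: openT.
rewrite (TE affine_space planar_poisson _ _ _ id_chart)//; first last.
- exact: poly_chart_admissible.
- exact: polyfun_in_O.
- exact: polyfun_in_O.
- exact: openT.
have -> : (planar_poisson c : V -> 'M[K]_n) = planar_poisson id_chart.
  rewrite [LHS]planar_components_symplectic//; apply/funext => y.
  by rewrite [RHS]planar_components_id.
have comp_cinv h : (h \o planar_map a b) \o planar_map a' b' = h.
  by apply/funext => v /=; rewrite a'b'K.
rewrite /= !comp_cinv; congr (E (jet _ _ _ _ _)).
by apply/rowP => i; rewrite !mxE a0 b0; do 2 case: eqP => // _.
Qed.

Lemma term0E f g p : @in_O _ _ affine_space setT f ->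
  @in_O _ _ affine_space setT g -> T 0 setT f g p = f p * g p.
Proof. by move=> fO gO; apply: (dq_term0 dq) => //; exact: openT. Qed.

Lemma term1E f g p : @in_O _ _ affine_space setT f ->
  @in_O _ _ affine_space setT g -> T 1 setT f g p = planar_bracket f g p.
Proof.
move=> fO gO; rewrite -bracket_inE; apply: (dq_term1 dq) => //.
- exact: openT.
- exact: poly_chart_admissible.
Qed.

Lemma star_assoc2 f g h p : polyfun f -> polyfun g -> polyfun h ->
  T 2 setT (fun v => f v * g v) h p + planar_bracket (planar_bracket f g) h p
    + T 2 setT f g p * h p
  = T 2 setT f (fun v => g v * h v) p + planar_bracket f (planar_bracket g h) p
    + f p * T 2 setT g h p.
Proof.
have T0 : polyfun ((fun=> 0) : V -> K) by exact: polyfun_cst.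
have bracketP u v : polyfun u -> polyfun v -> polyfun (planar_bracket u v).
  move=> uP vP; rewrite /planar_bracket; under eq_fun do rewrite -mulN1r.
  apply: polyfunD; last apply: (polyfunM (polyfun_cst _ (-1)));
    apply: polyfunM; exact: polyfun_partial.
have bracket0r u q : planar_bracket u (fun=> 0) q = 0.
  by rewrite /planar_bracket !partial_cst !mulr0 subrr.
have bracket0l u q : planar_bracket (fun=> 0) u q = 0.
  by rewrite /planar_bracket !partial_cst !mul0r subrr.
move=> fP gP hP.
have fO := polyfun_in_O fP; have gO := polyfun_in_O gP; have hO := polyfun_in_O hP.
have O0 := polyfun_in_O T0.
have fS := polyfun_in_Oeps fP; have gS := polyfun_in_Oeps gP.
have hS := polyfun_in_Oeps hP.
(* The coefficients of a product are known only to be sections, not polynomials; hence [term0E] and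
   [term1E] are stated with [in_O]. *)
have fgO : forall m, @in_O _ _ affine_space setT (T m setT f g).
  exact: (dq_section dq openT fS gS).
have ghO : forall m, @in_O _ _ affine_space setT (T m setT g h).
  exact: (dq_section dq openT gS hS).
have E0 u v : polyfun u -> polyfun v -> T 0 setT u v = fun q => u q * v q.
  by move=> uP vP; apply/funext => q; apply: term0E; exact: polyfun_in_O.
have E1 u v : polyfun u -> polyfun v -> T 1 setT u v = planar_bracket u v.
  by move=> uP vP; apply/funext => q; apply: term1E; exact: polyfun_in_O.
have := dq_assoc dq openT fS gS hS 2 (p := p) I.
rewrite (dq_linear dq openT (dq_section dq openT fS gS) hS)//.
rewrite (dq_linear dq openT fS (dq_section dq openT gS hS))//.
rewrite !big_ord_recl !big_ord0 /=.
rewrite -![S setT _ _ _]/(T _ _ _ _) /const_series /=.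
rewrite !term0E// !term1E// /bump /= !subn0 E0// E0// E1// E1//.
(* The zero coefficients of [const_series] meet only terms of order 0 and 1, which are explicit and
   vanish there. *)
by rewrite !bracket0r !bracket0l !mulr0 !mul0r !addr0 !addrA.
Qed.

(** * Automorphisms of the plane and the values of the second term on monomials *)

Lemma planar_map0 a b v : planar_map a b v 0 i0 = a v.
Proof. by rewrite mxE eqxx. Qed.

Lemma planar_map1 a b v : planar_map a b v 0 i1 = b v.
Proof. by rewrite mxE eq_sym (negPf i01) eqxx. Qed.

Lemma planar_mapK a b a' b' :
  (forall v, a' (planar_map a b v) = v 0 i0) ->
  (forall v, b' (planar_map a b v) = v 0 i1) ->
  cancel (planar_map a b) (planar_map a' b').
Proof.
move=> a'E b'E v; apply/rowP => k; rewrite mxE a'E b'E.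
by case: eqP => [->|k0] //; case: eqP => [->|k1] //;
  rewrite mxE (introF eqP k0) (introF eqP k1).
Qed.

Let mono k l (v : V) : K := v 0 i0 ^+ k * v 0 i1 ^+ l.

Lemma polyfun_mono k l : polyfun (mono k l).
Proof. by apply: polyfunM; apply: polyfunX; exact: polyfun_coord. Qed.

Ltac polyf := repeat first [exact: polyfun_mono | exact: polyfun_cst
  | exact: polyfun_coord | apply: polyfunX | apply: polyfunD | apply: polyfunM].

Let i10 : i1 == i0 = false.
Proof. by rewrite eq_sym (negPf i01). Qed.

Ltac partials := rewrite /planar_bracket ?partialM ?partialD ?partialM; try by polyf.

(** Invariance under the scaling multiplies the value by [2 ^+ (k + k') / 2 ^+ (l + l')]. In
    characteristic zero this factor is 1 only when the exponents agree. *)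
Lemma term_mono_weight (k l k' l' : nat) : (k + k' != l + l')%N ->
  B (mono k l) (mono k' l') = 0.
Proof.
move=> ne.
pose a (v : V) := 2 * v 0 i0; pose b (v : V) := 2^-1 * v 0 i1.
pose a' (v : V) := 2^-1 * v 0 i0; pose b' (v : V) := 2 * v 0 i1.
have aP : polyfun a by polyf.
have bP : polyfun b by polyf.
have a'P : polyfun a' by polyf.
have b'P : polyfun b' by polyf.
have abK : cancel (planar_map a b) (planar_map a' b').
  by apply: planar_mapK => v; rewrite /a' /b' ?planar_map0 ?planar_map1 /a /b; field.
have a'b'K : cancel (planar_map a' b') (planar_map a b).
  by apply: planar_mapK => v; rewrite /a /b ?planar_map0 ?planar_map1 /a' /b'; field.
have ab1 v : planar_bracket a b v = 1.
  rewrite /a /b; partials.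
  by rewrite !partial_cst !partial_coord !eqxx i10 (negPf i01) /=; field.
have a0 : a 0 = 0 by rewrite /a !mxE; ring.
have b0 : b 0 = 0 by rewrite /b !mxE; ring.
have monoE p q : mono p q \o planar_map a b = fun v => 2 ^+ p / 2 ^+ q * mono p q v.
  apply/funext => v; rewrite /mono /= planar_map0 planar_map1 /a /b.
  by rewrite !exprMn exprVn; ring.
have := @term_planar_map 2 a b a' b' (mono k l) (mono k' l') isT aP bP a'P b'P
  abK a'b'K ab1 a0 b0 (polyfun_mono _ _) (polyfun_mono _ _).
rewrite !monoE termZl ?termZr//; try by polyf.
move=> /eqP; rewrite mulrA -subr_eq0 -[X in _ - X]mul1r -mulrBl mulf_eq0.
case/orP => [|/eqP//]; rewrite subr_eq0 mulrACA -invfM -!exprD => /eqP /divr1_eq.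
move/eqP; rewrite -!natrX eqr_nat eqn_exp2l// => /eqP e.
by rewrite e eqxx in ne.
Qed.

Lemma term_linear_shear f g : polyfun f -> polyfun g ->
  let phi := planar_map (fun v => v 0 i0 + v 0 i1) (fun v => v 0 i1) in
  B (f \o phi) (g \o phi) = B f g.
Proof.
move=> fP gP.
pose a (v : V) := v 0 i0 + v 0 i1; pose a' (v : V) := v 0 i0 + (-1) * v 0 i1.
pose b (v : V) := v 0 i1.
apply: (@term_planar_map 2 a b a' b) => //; try by polyf.
- by apply: planar_mapK => v; rewrite /a' /b ?planar_map0 ?planar_map1 // /a; ring.
- by apply: planar_mapK => v; rewrite /a /b ?planar_map0 ?planar_map1 // /a'; ring.
- move=> v; rewrite /a /b; partials.
  by rewrite !partial_coord !eqxx i10 (negPf i01) /=; ring.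
- by rewrite /a !mxE addr0.
- by rewrite /b !mxE.
Qed.

(** The binomial expansion of the cube of x + y, with the monomial that survives put first and a
    coefficient [1] inserted to fit the shape [a * f + g] of [termPl] and [termPr]. *)
Lemma mono_linear_shear :
  let phi := planar_map (fun v => v 0 i0 + v 0 i1) (fun v => v 0 i1) in
  mono 0 1 \o phi = mono 0 1 /\
  mono 3 0 \o phi = fun v => 3 * mono 2 1 v +
    (1 * mono 3 0 v + (3 * mono 1 2 v + mono 0 3 v)).
Proof.
by split; apply/funext => v; rewrite /mono /= planar_map0 planar_map1; ring.
Qed.

Lemma term_y_xxy : B (mono 0 1) (mono 2 1) = 0.
Proof.
have := term_linear_shear (polyfun_mono 0 1) (polyfun_mono 3 0).
rewrite /= mono_linear_shear.1 mono_linear_shear.2 !termPr; try by polyf.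
(* Only [mono 2 1] balances the weight of [mono 0 1], so three times the wanted value is zero. *)
rewrite (@term_mono_weight 0 1 3 0)// (@term_mono_weight 0 1 1 2)//
  (@term_mono_weight 0 1 0 3)//.
by rewrite !mulr0 !addr0 => /eqP; rewrite mulf_eq0 pnatr_eq0 => /eqP.
Qed.

Lemma term_xxy_y : B (mono 2 1) (mono 0 1) = 0.
Proof.
have := term_linear_shear (polyfun_mono 3 0) (polyfun_mono 0 1).
rewrite /= mono_linear_shear.1 mono_linear_shear.2 !termPl; try by polyf.
rewrite (@term_mono_weight 3 0 0 1)// (@term_mono_weight 1 2 0 1)//
  (@term_mono_weight 0 3 0 1)//.
by rewrite !mulr0 !addr0 => /eqP; rewrite mulf_eq0 pnatr_eq0 => /eqP.
Qed.

Lemma term_yy_xx : B (mono 0 2) (mono 2 0) = 0.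
Proof.
pose a (v : V) := v 0 i0; pose b (v : V) := v 0 i1 + v 0 i0 * v 0 i0.
pose b' (v : V) := v 0 i1 + (-1) * (v 0 i0 * v 0 i0).
have aP : polyfun a by polyf.
have bP : polyfun b by polyf.
have b'P : polyfun b' by polyf.
have abK : cancel (planar_map a b) (planar_map a b').
  by apply: planar_mapK => v; rewrite /a /b' ?planar_map0 ?planar_map1 // /a /b; ring.
have ab'K : cancel (planar_map a b') (planar_map a b).
  by apply: planar_mapK => v; rewrite /a /b ?planar_map0 ?planar_map1 // /a /b'; ring.
have ab1 v : planar_bracket a b v = 1.
  rewrite /a /b; partials.
  by rewrite !partial_coord !eqxx i10 (negPf i01) /=; ring.
have a0 : a 0 = 0 by rewrite /a !mxE.
have b0 : b 0 = 0 by rewrite /b !mxE; ring.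
have := @term_planar_map 2 a b a b' (mono 0 2) (mono 0 1) isT aP bP aP b'P
  abK ab'K ab1 a0 b0 (polyfun_mono _ _) (polyfun_mono _ _).
have -> : mono 0 2 \o planar_map a b =
    fun v => 2 * mono 2 1 v + (1 * mono 0 2 v + mono 4 0 v).
  by apply/funext => v; rewrite /mono /= planar_map0 planar_map1 /a /b; ring.
have -> : mono 0 1 \o planar_map a b =
    fun v => 1 * mono 0 1 v + mono 2 0 v.
  by apply/funext => v; rewrite /mono /= planar_map0 planar_map1 /a /b; ring.
rewrite !termPl ?termPr; try by polyf.
(* Of the six expanded values, four are unbalanced and one is [term_xxy_y]; the right-hand side is
   unbalanced too, so the remaining value is zero. *)
rewrite term_xxy_y (@term_mono_weight 2 1 2 0)// (@term_mono_weight 0 2 0 1)//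
  (@term_mono_weight 4 0 0 1)// (@term_mono_weight 4 0 2 0)//.
by rewrite !(mul1r, mulr0, addr0, add0r).
Qed.

Lemma no_natural_star : False.
Proof.
(* [X] is a product rather than a power so that [partialM] applies; it is identified with a monomial
   only after the brackets are computed. *)
pose X (v : V) := v 0 i0 * v 0 i0; pose Y (v : V) := v 0 i1.
have XP : polyfun X by polyf.
have YP : polyfun Y by polyf.
have := star_assoc2 0 YP YP XP.
have YX : planar_bracket Y X = fun v => - 2 * v 0 i0.
  apply/funext => v; rewrite /X /Y; partials.
  by rewrite !partial_coord !eqxx i10 (negPf i01) /=; ring.
have YYX : planar_bracket (planar_bracket Y Y) X 0 = 0.
  rewrite (_ : planar_bracket Y Y = fun=> 0).
    by rewrite /planar_bracket !partial_cst !mul0r subrr.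
  by apply/funext => v; rewrite /planar_bracket mulrC subrr.
have YYX' : planar_bracket Y (planar_bracket Y X) 0 = 2.
  rewrite YX /Y; partials.
  by rewrite !partial_coord !partial_cst !eqxx i10 (negPf i01) /=; ring.
have -> : (fun v => Y v * Y v) = mono 0 2.
  by apply/funext => v; rewrite /mono /Y expr0 mul1r.
have -> : (fun v => Y v * X v) = mono 2 1.
  by apply/funext => v; rewrite /mono /Y mulrC.
(* Both functions vanish at the origin, which removes the two outer products of the associativity
   identity. *)
have Y0 : Y 0 = 0 by rewrite /Y mxE.
have X0 : X 0 = 0 by rewrite /X mxE mulr0.
rewrite YYX YYX' X0 Y0 mulr0 mul0r !addr0.
have -> : X = mono 2 0 by apply/funext => v; rewrite /mono expr0 mulr1.
have -> : Y = mono 0 1 by apply/funext => v; rewrite /mono expr0 mul1r.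
rewrite term_yy_xx term_y_xxy add0r => /eqP.
by rewrite eq_sym pnatr_eq0.
Qed.

End Contradiction.
End Model.

Theorem theorem6 (R : realType) (n : nat) (hn : (2 <= n)%N) :
  ~ (exists star : product_family R n, natural_deformation_quantization star)
  /\
  ~ (exists star : product_family (complex R) n,
       natural_deformation_quantization star).
Proof.
(* The indices 0 and 1 span the plane: [hn] unfolds to [1 < n], and [ltnW] weakens it to [0 < n]. *)
have h01 : Ordinal (ltnW hn) != Ordinal hn by [].
split=> -[star star_natural].
- exact: (no_natural_star (@second_countable_real R n) h01 star_natural).
- exact: (no_natural_star (@second_countable_complex R n) h01 star_natural).
Qed.
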